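(* For $\lambda\in(0,\infty)$, let $\mu$ be the law of the friendship bias $\Delta_\phi$ of the root of the Galton-Watson tree with Poisson($\lambda$) offspring distribution (the local limit of the homogeneous Erdős-Rényi random graph with edge probability $\frac{\lambda}{n}\wedge1$). Then for every $\lambda\in(0,\infty)$, $$\mu([0,\infty))=\sum_{k=0}^\infty\frac{e^{-\lambda}\lambda^k}{k!}\sum_{l\ge k(k-1)}\frac{e^{-\lambda k}(\lambda k)^l}{l!}$$ (with $0^0=1$). In particular, $\lim_{\lambda\downarrow0}\mu([0,\infty))=1$ and $\lim_{\lambda\to\infty}\mu([0,\infty))=\frac12$, i.e., the friendship paradox is significant for both small and large $\lambda$, and becomes marginally significant in the limit as $\lambda\to\infty$.
   Context: Let $d_\phi$ be the number of children of the root $\phi$ and $d_j$ the number of children of the $j$-th child of the root; here $d_\phi,d_1,d_2,\ldots$ are i.i.d. Poisson($\lambda$) random variables. The friendship bias of the root is $$\Delta_\phi=\Big[\frac1{d_\phi}\sum_{j=1}^{d_\phi}(d_j+1)-d_\phi\Big]\mathbb 1_{\{d_\phi\ne0\}}$$ (so $\Delta_\phi=0$ when $d_\phi=0$), and $\mu$ (depending on $\lambda$) is its law on $\mathbb R$. The friendship paradox is called significant when $\mu([0,\infty))\ge\frac12$, insignificant when $\mu([0,\infty))<\frac12$, and marginally significant when $\mu([0,\infty))=\frac12$. *)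

(* Defs.v *)
From HB Require Import structures.
From mathcomp Require Import all_boot all_order all_algebra.
From mathcomp Require Import all_classical all_reals all_analysis.
From mathcomp Require Import measurable_realfun.

Set Implicit Arguments.
Unset Strict Implicit.
Unset Printing Implicit Defensive.

Import Order.TTheory GRing.Theory Num.Theory.
Import numFieldNormedType.Exports.

Local Open Scope classical_set_scope.
Local Open Scope ring_scope.

(* Mutual independence: the product rule over every finite subfamily. *)
Definition mutually_independent (R : realType) (d d' : measure_display)
    (T : measurableType d) (T' : measurableType d') (P : probability T R)
    (I : choiceType) (X : I -> {RV P >-> T'}) : Prop :=
  forall (s : seq I) (A : I -> set T'), uniq s ->
    (forall i, measurable (A i)) ->
    (P (\bigcap_(i in [set` s]) (X i @^-1` A i)) =
     \prod_(i <- s) P (X i @^-1` A i))%E.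

(* A Galton-Watson tree is encoded by its offspring numbers in Ulam-Harris
   labelling: the root is [::], the children of the vertex w are
   rcons w 0, ..., rcons w (N w).-1, and N w is the number of children of w.
   Labels that do not occur in the tree also carry an offspring number, which
   plays no role. *)
Definition poisson_galton_watson (R : realType) (d : measure_display)
    (T : measurableType d) (P : probability T R) (lambda : R)
    (N : seq nat -> {RV P >-> nat}) : Prop :=
  (forall w k, P [set x | N w x = k] = (poisson_pmf lambda k)%:E) /\
  mutually_independent N.

Section root_bias.
Context (R : realType) (d : measure_display) (T : measurableType d)
  (P : probability T R) (N : seq nat -> {RV P >-> nat}).

Definition root_bias (x : T) : R :=
  let deg := N [::] x in
  (deg%:R^-1 * (\sum_(j < deg) ((N [:: nat_of_ord j] x)%:R + 1)) - deg%:R)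
  * (deg != 0%N)%:R.

Lemma measurable_root_bias : measurable_fun setT root_bias.
Proof.
have mN (w : seq nat) : measurable_fun setT (fun x => (N w x)%:R : R).
  by apply: (@measurableT_comp _ _ _ _ _ _ (fun n : nat => n%:R : R)).
move=> _ Y mY; rewrite setTI.
pose f k x : R := (k%:R^-1 * (\sum_(j < k) ((N [:: nat_of_ord j] x)%:R + 1))
  - k%:R) * (k != 0%N)%:R.
have -> : root_bias @^-1` Y =
    \bigcup_k ((N [::] @^-1` [set k]) `&` (f k @^-1` Y)).
  apply/seteqP; split => x /=.
    by move=> Yx; exists (N [::] x).
  by case=> k _ [/= Nk]; rewrite /f -Nk.
apply: bigcup_measurable => k _; apply: measurableI.
  by rewrite -[X in measurable X]setTI; exact: measurable_funPT.
rewrite -[X in measurable X]setTI.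
have mf : measurable_fun setT (f k).
  apply: measurable_funM => //; apply: measurable_funB => //.
  apply: measurable_funM => //; apply: measurable_sum => j.
  exact: measurable_funD.
exact: mf.
Qed.

HB.instance Definition _ :=
  isMeasurableFun.Build _ _ T R root_bias measurable_root_bias.

End root_bias.

Definition root_bias_law (R : realType) (lambda : R)
    (mu : probability (measurableTypeR R) R) : Prop :=
  exists (d : measure_display) (T : measurableType d) (P : probability T R)
    (N : seq nat -> {RV P >-> nat}),
    poisson_galton_watson lambda N /\
    forall A : set R, measurable A -> mu A = distribution P (root_bias N) A.

Definition significant (R : realType)
    (mu : probability (measurableTypeR R) R) : Prop :=
  ((2^-1 : R)%:E <= mu `[0%R, +oo[%classic)%E.

(* Main.v *)
Require Import Defs.
From mathcomp Require Import all_boot all_order all_algebra.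
From mathcomp Require Import all_classical all_reals all_analysis.
From mathcomp Require Import ring lra zify.

Import Order.TTheory GRing.Theory Num.Theory.
Import numFieldNormedType.Exports.

Local Open Scope classical_set_scope.
Local Open Scope ring_scope.

(* Given that the root has k children, its bias is nonnegative iff the number
   of its grandchildren, which is Poisson(lambda k), is at least k (k - 1);
   this gives the series.

   For large lambda let N - 1 <= lambda < N and q = P(Poisson(lambda) = N).
   The offspring numbers k <= N alone have probability at least
   1/2 + (N - lambda) q + c q for some constant c > 0: indeed
   P(Poisson(N) <= N) >= 1/2 + c P(Poisson(N) = N).  Replacing the sharp
   cutoff k <= N by the conditional probabilities changes this by
   q (E floor(W + lambda + 1 - N) + o(1)), where W is a centred grandchild
   count, and E floor(W + t) >= t - 1 because W has mean 0.  The total is at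
   least 1/2 + (c - o(1)) q, so no central limit theorem is needed.  All
   corrections are O(q), and q tends to 0, hence the limit 1/2. *)

(** * Poisson weights *)

Definition pois {R : realType} (m : R) (l : nat) : R :=
  expR (- m) * m ^+ l / l`!%:R.

(* P(X < n), with strict inequality. *)
Definition pois_cdf {R : realType} (m : R) (n : nat) : R :=
  \sum_(l < n) pois m l.

Section poisson.
Context {R : realType}.
Implicit Types (m a b t : R) (k l n T u v : nat).

Lemma pois_ge0 m l : 0 <= m -> 0 <= pois m l.
Proof. by move=> m0; rewrite /pois !mulr_ge0// ?expR_ge0// exprn_ge0. Qed.

Lemma poisS m l : pois m l.+1 * l.+1%:R = pois m l * m.
Proof.
rewrite /pois exprS factS natrM.
have ? : (l`!%:R : R) != 0 by rewrite pnatr_eq0 -lt0n fact_gt0.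
by field; apply/andP.
Qed.

Lemma pois_cdfS m n : pois_cdf m n.+1 = pois_cdf m n + pois m n.
Proof. by rewrite /pois_cdf big_ord_recr. Qed.

Lemma pois_cdf0 m : pois_cdf m 0 = 0.
Proof. by rewrite /pois_cdf big_ord0. Qed.

Lemma le_pois_cdf m n T : 0 <= m -> (n <= T)%N -> pois_cdf m n <= pois_cdf m T.
Proof.
move=> m0; elim: T => [|T IH]; first by rewrite leqn0 => /eqP ->.
rewrite leq_eqVlt => /predU1P[-> //|]; rewrite ltnS => /IH.
by rewrite pois_cdfS; have := @pois_ge0 _ T m0; lra.
Qed.

Lemma cvg_pois_cdf m : pois_cdf m n @[n --> \oo] --> (1 : R).
Proof.
have -> : pois_cdf m = (fun n => expR (- m) * series (exp_coeff m) n).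
  apply/funext => n; rewrite /pois_cdf /series /= big_mkord mulr_sumr.
  by apply: eq_bigr => i _; rewrite /pois exp_coeffE -mulrA (mulrC (m ^+ _)).
rewrite -[X in _ --> X](expRxMexpNx_1 m) mulrC; apply: cvgM; first exact: cvg_cst.
exact: is_cvg_series_exp_coeff.
Qed.

Lemma pois_cdf_le1 m n : 0 <= m -> pois_cdf m n <= 1.
Proof.
move=> m0; rewrite -(cvg_lim _ (cvg_pois_cdf m))//.
apply: nondecreasing_cvgn_le; last by apply/cvg_ex; exists 1; exact: cvg_pois_cdf.
by move=> i j; exact: le_pois_cdf.
Qed.

Lemma cvg_pois m : pois m n @[n --> \oo] --> (0 : R).
Proof.
have -> : pois m = (fun n => pois_cdf m (n + 1) - pois_cdf m n).
  by apply/funext => n; rewrite addn1 pois_cdfS addrC addKr.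
rewrite -[X in _ --> X](subrr 1); apply: cvgB; last exact: cvg_pois_cdf.
by rewrite (cvg_shiftn 1); exact: cvg_pois_cdf.
Qed.

Lemma poisD a b l :
  pois (a + b) l = \sum_(i < l.+1) pois a i * pois b (l - i).
Proof.
rewrite /pois opprD expRD exprDn mulr_sumr mulr_suml.
rewrite [LHS](reindex_inj rev_ord_inj)/=; apply: eq_bigr => i _.
have il : (i <= l)%N by rewrite -ltnS.
rewrite subSS subKn// bin_sub// -mulr_natr -(bin_fact il) !natrM.
have ? : (i`!%:R : R) != 0 by rewrite pnatr_eq0 -lt0n fact_gt0.
have ? : ((l - i)`!%:R : R) != 0 by rewrite pnatr_eq0 -lt0n fact_gt0.
have ? : (('C(l, i))%:R : R) != 0 by rewrite pnatr_eq0 -lt0n bin_gt0.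
by field; apply/and3P.
Qed.

Lemma pois_cdfD a b n :
  pois_cdf (a + b) n = \sum_(i < n) \sum_(j < n | (i + j < n)%N) pois a i * pois b j.
Proof.
rewrite /pois_cdf.
under eq_bigr => l _ do rewrite poisD.
under eq_bigr => l _.
  rewrite (big_ord_widen n (fun i => pois a i * pois b (l - i))); last exact: ltn_ord.
  over.
rewrite /= (exchange_big_dep xpredT)//=; apply: eq_bigr => i _.
rewrite -(big_mkord (fun j => i + j < n)%N (fun j => pois a i * pois b j)).
rewrite -(big_mkord (fun j => i < j.+1)%N (fun j => pois a i * pois b (j - i))).
rewrite (big_cat_nat (n := i))//=; last exact: ltnW.
rewrite big_nat_cond big1 ?add0r; last by move=> j h; exfalso; lia.
rewrite [RHS](big_cat_nat (n := (n - i)%N))//=; last exact: leq_subr.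
rewrite [X in _ = _ + X]big_nat_cond [X in _ = _ + X]big1 ?addr0;
  last by move=> j h; exfalso; lia.
rewrite -{1}(add0n (i : nat)) big_addn big_nat_cond [RHS]big_nat_cond.
by apply: eq_big => j; [lia|rewrite addnK].
Qed.

(** A union bound: a sum below [u + v] forces one of the two summands below its own level. *)
Lemma pois_cdf_split a b u v : 0 <= a -> 0 <= b ->
  pois_cdf (a + b) (u + v) <= pois_cdf a u + pois_cdf b v.
Proof.
move=> a0 b0; rewrite pois_cdfD; set n := (u + v)%N.
have p0 i j : 0 <= pois a i * pois b j by rewrite mulr_ge0 ?pois_ge0.
have indE (m : R) w : 0 <= m -> (w <= n)%N ->
    \sum_(i < n) pois m i * (i < w)%:R = pois_cdf m w.
  move=> m0 wn; rewrite /pois_cdf (big_ord_widen n (pois m))// [RHS]big_mkcond /=.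
  by apply: eq_bigr => i _; case: ifP; rewrite ?mulr1 ?mulr0.
apply: (@le_trans _ _ (\sum_(i < n) \sum_(j < n)
   (pois a i * (i < u)%:R * pois b j + pois a i * (pois b j * (j < v)%:R)))).
  apply: ler_sum => i _; rewrite big_mkcond /=; apply: ler_sum => j _.
  have := p0 i j; set x := pois a i; set y := pois b j => xy0.
  have := xy0.
  case: ifP => h; case: ltnP => h1; case: ltnP => h2 /=;
    rewrite ?mulr1 ?mulr0 ?mul0r ?addr0 ?add0r //; try lra.
  by move: h; rewrite ltnNge (leq_add h1 h2).
under eq_bigr => i _ do rewrite big_split /= -!mulr_sumr.
rewrite big_split/= -!mulr_suml !indE ?leq_addl ?leq_addr//.
apply: lerD; [apply: ler_piMr|apply: ler_piMl];
  rewrite -/(pois_cdf _ _) ?pois_cdf_le1// -(pois_cdf0 a) -?(pois_cdf0 b) ?le_pois_cdf//.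
by rewrite pois_cdf0 -(pois_cdf0 b) le_pois_cdf.
Qed.

(** * Moments and Chebyshev bounds *)

(** By [poisS] the sum telescopes. The right-hand side is the boundary term of the truncation; it
    vanishes as [n] grows, so finite sums can stand in for expectations. *)
Lemma pois_moment1 m n :
  \sum_(l < n.+1) (l%:R - m) * pois m l = - m * pois m n.
Proof.
elim: n => [|n IH]; first by rewrite big_ord1 sub0r.
rewrite big_ord_recr /= IH mulrBl (mulrC n.+1%:R) poisS; ring.
Qed.

Lemma pois_moment2 m n :
  \sum_(l < n.+1) (l%:R - m) ^+ 2 * pois m l =
  m * pois_cdf m n.+1 - m * (n.+1%:R - m) * pois m n.
Proof.
elim: n => [|n IH].
  by rewrite big_ord1 pois_cdfS pois_cdf0 sub0r; ring.
rewrite big_ord_recr /= IH [in RHS]pois_cdfS.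
have := poisS m n; rewrite -[n.+2]addn1 natrD.
move: (pois m n) (pois m n.+1) (n.+1%:R : R) => x y z h.
rewrite (_ : m * (z - m) * x = (z - m) * (x * m)); last by ring.
by rewrite -h; ring.
Qed.

(** Partial sums increase, and once the cutoff exceeds [m] the boundary term of [pois_moment2] has
    the favourable sign. *)
Lemma pois_variance_le m n : 0 <= m ->
  \sum_(l < n) (l%:R - m) ^+ 2 * pois m l <= m.
Proof.
move=> m0; pose V n := \sum_(l < n) (l%:R - m) ^+ 2 * pois m l.
have VS j i : (j <= i)%N -> V j <= V i.
  elim: i => [|i IH]; first by rewrite leqn0 => /eqP ->.
  rewrite leq_eqVlt => /predU1P[-> //|]; rewrite ltnS => /IH /le_trans; apply.
  by rewrite /V big_ord_recr/= lerDl mulr_ge0 ?sqr_ge0 ?pois_ge0.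
have [i mi] : exists i : nat, m <= i%:R.
  by exists (Num.Def.archi_bound m); rewrite ltW// archi_boundP.
apply: (@le_trans _ _ (V (n + i).+1)); first by apply: VS; lia.
rewrite /V pois_moment2.
have h1 := pois_cdf_le1 m (n + i).+1 m0.
have h2 := pois_ge0 m (n+i) m0.
have h3 : 0 <= (n + i).+1%:R - m.
  by rewrite subr_ge0 (le_trans mi)// ler_nat; lia.
have h4 : 0 <= m * ((n + i).+1%:R - m) * pois m (n + i).
  by apply: mulr_ge0 => //; apply: mulr_ge0.
have h5 : m * pois_cdf m (n + i).+1 <= m by rewrite ler_piMr.
lra.
Qed.

Lemma pois_lower_tail m t T : 0 <= m -> 0 < t -> T%:R <= m - t ->
  pois_cdf m T <= m / t ^+ 2.
Proof.
move=> m0 t0 Tm; rewrite ler_pdivlMr ?exprn_gt0// mulrC.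
apply: le_trans (pois_variance_le m T m0); rewrite /pois_cdf mulr_sumr.
apply: ler_sum => l _; apply: ler_wpM2r; first exact: pois_ge0.
have lT : (l%:R : R) <= T%:R by rewrite ler_nat ltnW.
nra.
Qed.

Lemma pois_upper_tail m t T : 0 <= m -> 0 < t -> m + t <= T%:R ->
  1 - pois_cdf m T <= m / t ^+ 2.
Proof.
move=> m0 t0 Tm; rewrite ler_pdivlMr ?exprn_gt0// mulrC.
have : (t ^+ 2 * (pois_cdf m n - pois_cdf m T)) @[n --> \oo] --> t ^+ 2 * (1 - pois_cdf m T).
  apply: cvgM; first exact: cvg_cst.
  by apply: cvgB; [exact: cvg_pois_cdf|exact: cvg_cst].
move=> cv; rewrite -(cvg_lim _ cv)//; apply: limr_le; first by apply/cvg_ex; eexists; exact: cv.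
exists T => // n /= Tn; apply: le_trans (pois_variance_le m n m0).
rewrite /pois_cdf -!(big_mkord xpredT (fun l => pois m l)).
rewrite -(big_mkord xpredT (fun l => (l%:R - m) ^+ 2 * pois m l)).
rewrite (big_cat_nat (n := T) (m := 0%N) (p := n))//= [leRHS](big_cat_nat (n := T))//=.
rewrite addrAC subrr add0r mulr_sumr ler_wpDl//.
  by apply: sumr_ge0 => l _; rewrite mulr_ge0 ?sqr_ge0 ?pois_ge0.
apply: ler_sum_nat => l /andP[Tl _]; apply: ler_wpM2r; first exact: pois_ge0.
have lT : (T%:R : R) <= l%:R by rewrite ler_nat.
nra.
Qed.

(** * Unimodality and reflection of the weights *)

Lemma pois_le_succ m l : 0 <= m -> l.+1%:R <= m -> pois m l <= pois m l.+1.
Proof.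
move=> m0 lm; rewrite -(@ler_pM2r _ l.+1%:R) ?ltr0n// poisS.
by rewrite ler_wpM2l ?pois_ge0.
Qed.

Lemma pois_ge_succ m l : 0 <= m -> m <= l.+1%:R -> pois m l.+1 <= pois m l.
Proof.
move=> m0 lm; rewrite -(@ler_pM2r _ l.+1%:R) ?ltr0n// poisS.
by rewrite ler_wpM2l ?pois_ge0.
Qed.

Lemma pois_le_mode m n k : n%:R <= m -> m <= n.+1%:R -> pois m k <= pois m n.
Proof.
move=> nm mn; have m0 : 0 <= m by rewrite (le_trans _ nm).
have [kn|nk] := leqP k n.
  move: kn nm {mn}; elim: n => [|n IH]; first by rewrite leqn0 => /eqP ->.
  rewrite leq_eqVlt => /predU1P[-> //|]; rewrite ltnS => kn nm.
  apply: le_trans (pois_le_succ m n m0 nm); apply: IH => //.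
  by rewrite (le_trans _ nm)// ler_nat.
elim: k nk => [//|k IH]; rewrite ltnS leq_eqVlt => /predU1P[<-|nk].
  exact: pois_ge_succ.
apply: le_trans (IH nk); apply: pois_ge_succ => //.
by rewrite (le_trans mn)// ler_nat ltnW.
Qed.

(** Induction on [j]: one step outwards multiplies the left weight by [(n-j-1)/m] and the right one
    by [m/(n+j+1)], and [(n-j-1)(n+j+1) <= n^2 <= m^2]. *)
Lemma pois_mirror m n j : n%:R <= m -> (j < n)%N ->
  pois m (n - j.+1) <= pois m (n + j).
Proof.
move=> nm; have m0 : 0 <= m by rewrite (le_trans _ nm).
elim: j => [|j IH] jn.
  by rewrite addn0; case: n jn nm => // n _ nm; rewrite subSS subn0 pois_le_succ.
have {IH}IH := IH (ltnW jn).
have -> : (n + j.+1 = (n + j).+1)%N by rewrite addnS.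
have := poisS m (n + j); have := poisS m (n - j.+2).
have -> : ((n - j.+2).+1 = n - j.+1)%N by lia.
have := pois_ge0 m (n + j).+1 m0.
have m1 : 0 < m by apply: lt_le_trans nm; rewrite ltr0n; lia.
have nj : ((n - j.+1)%:R * (n + j).+1%:R : R) <= m ^+ 2.
  apply: (@le_trans _ _ (n%:R ^+ 2)); last by rewrite lerXn2r// nnegrE.
  by rewrite -natrM -natrX ler_nat; nia.
move: (pois m (n - j.+2)) (pois m (n - j.+1)) (pois m (n + j)) (pois m (n + j).+1) IH
  => p1 p2 p3 p4 IH p40 e1 e2.
rewrite -(@ler_pM2r _ (m ^+ 2)) ?exprn_gt0//.
apply: le_trans (ler_wpM2l p40 nj); rewrite [leRHS]mulrA [leRHS]mulrAC e2 expr2 mulrA -e1.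
by rewrite [leRHS]mulrAC; apply: ler_wpM2r; [exact: ltW|exact: ler_wpM2r].
Qed.

(* Reflecting about n - 1/2 increases the weights below n. *)
Lemma pois_cdf_le_half m n : n%:R <= m -> pois_cdf m n <= 2^-1.
Proof.
move=> nm; have m0 : 0 <= m by rewrite (le_trans _ nm).
have := pois_cdf_le1 m (n + n) m0.
rewrite /pois_cdf big_split_ord /=.
suff : \sum_(i < n) pois m i <= \sum_(i < n) pois m (n + i) by lra.
rewrite (reindex_inj rev_ord_inj)/=; apply: ler_sum => j _; exact: pois_mirror.
Qed.

(** * Derivatives in the parameter *)

Lemma is_derive_pois n m :
  is_derive m 1 (fun x => pois x n.+1) (pois m n - pois m n.+1).
Proof.
have -> : (fun x : R => pois x n.+1) =
    n.+1`!%:R^-1 *: ((fun x => expR (- x)) * ((id : R -> R) ^+ n.+1)).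
  by apply/funext => x; rewrite /pois/= mulrC !fctE.
apply: is_derive_eq; rewrite /pois factS natrM.
have ? : (n`!%:R : R) != 0 by rewrite pnatr_eq0 -lt0n fact_gt0.
rewrite /= !fctE /GRing.scale /= exprS.
by field; apply/andP.
Qed.

(** Summing [is_derive_pois] telescopes and leaves only the top weight. *)
Lemma is_derive_pois_cdf n m : is_derive m 1 (fun x => pois_cdf x n.+1) (- pois m n).
Proof.
elim: n => [|n IH].
  have -> : (fun x : R => pois_cdf x 1) = (fun x => expR (- x)).
    by apply/funext => x; rewrite pois_cdfS pois_cdf0 add0r /pois expr0 divr1 mulr1.
  by apply: is_derive_eq; rewrite /pois expr0 divr1 mulr1 mulrN1.
have -> : (fun x : R => pois_cdf x n.+2) =
    (fun x => pois_cdf x n.+1) + (fun x => pois x n.+1).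
  by apply/funext => x; rewrite pois_cdfS.
have H := is_derive_pois n m.
by apply: is_derive_eq; rewrite addrA addNr sub0r.
Qed.
End poisson.

(** * The median of the Poisson distribution *)

Section median.
Context {R : realType}.
Implicit Types (m s u : R) (n N : nat).

Lemma derive_ge_increment (f df : R -> R) (a b K : R) : a <= b ->
  (forall x, a <= x <= b -> is_derive x 1 f (df x)) ->
  (forall x, a <= x <= b -> K <= df x) ->
  K * (b - a) <= f b - f a.
Proof.
move=> ab fdf Kdf.
have [] := @MVT_segment R f df a b ab.
- by move=> x; rewrite in_itv/= => /andP[ax xb]; apply: fdf; rewrite !ltW.
- apply: derivable_within_continuous => x; rewrite in_itv/= => xab.
  by have := fdf x xab; case.
move=> c; rewrite in_itv/= => cab ->.
by rewrite ler_wpM2r ?subr_ge0// Kdf.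
Qed.

Lemma pois_nondecreasing m s n : 0 <= m -> m <= s -> s <= n%:R -> pois m n <= pois s n.
Proof.
case: n => [|n] m0 ms sn; first by rewrite (_ : m = s)//; lra.
rewrite -subr_ge0 -(mul0r (s - m)).
apply: (derive_ge_increment (fun x => pois x n.+1) (fun x => pois x n - pois x n.+1)) => //.
  by move=> x _; exact: is_derive_pois.
by move=> x /andP[mx xs]; rewrite subr_ge0 pois_ge_succ//; lra.
Qed.

(** Minus the cdf has derivative [pois x n] in its parameter, which is at least [pois m n] on
    [[m, n]]. This supplies the gain [(N - lambda) q]. *)
Lemma pois_cdf_below m n : 0 <= m -> m <= n%:R ->
  pois_cdf n%:R n.+1 + (n%:R - m) * pois m n <= pois_cdf m n.+1.
Proof.
move=> m0 mn; suff : pois m n * (n%:R - m) <= - pois_cdf n%:R n.+1 - - pois_cdf m n.+1 by lra.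
apply: (derive_ge_increment (fun x => - pois_cdf x n.+1) (fun x => pois x n)) => //.
  move=> x _; have := is_derive_pois_cdf n x => ?.
  by apply: is_derive_eq; rewrite opprK.
by move=> x /andP[mx xn]; exact: pois_nondecreasing.
Qed.

(** Both sides agree at 0, and their difference has derivative [2 x^4 / (1 - x^2) >= 0]. *)
Lemma ln_ratio_ge u : 0 <= u < 1 ->
  2 * u + 2 / 3 * u ^+ 3 <= ln (1 + u) - ln (1 - u).
Proof.
move=> /andP[u0 u1].
pose f : R -> R := (fun y => ln (1 + y)) - (fun y => ln (1 - y)) - 2 *: (id : R -> R)
  - (2 / 3) *: ((id : R -> R) ^+ 3).
have : 0 * (u - 0) <= f u - f 0.
  apply: (derive_ge_increment f (fun x => (1 + x)^-1 + (1 - x)^-1 - 2 - 2 * x ^+ 2)) => //.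
    move=> x /andP[x0 xu].
    have ? : 0 < 1 + x by lra.
    have ? : 0 < 1 - x by lra.
    have d1 : is_derive x 1 (fun y => ln (1 + y)) (1 + x)^-1.
      have ? := @is_derive1_ln R (1 + x) ltac:(assumption).
      by apply: is_derive_eq; rewrite add0r mulr1.
    have d2 : is_derive x 1 (fun y => ln (1 - y)) (- (1 - x)^-1).
      have ? := @is_derive1_ln R (1 - x) ltac:(assumption).
      by apply: is_derive_eq; rewrite add0r mul1r mulrN1.
    apply: is_derive_eq; rewrite /GRing.scale /=; field.
    by apply/andP; split; rewrite gt_eqF.
  move=> x /andP[x0 xu].
  have ? : 0 < 1 + x by lra.
  have ? : 0 < 1 - x by lra.
  have -> : (1 + x)^-1 + (1 - x)^-1 - 2 - 2 * x ^+ 2 = 2 * x ^+ 4 / ((1 + x) * (1 - x)).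
    by field; apply/andP; split; rewrite gt_eqF.
  by rewrite divr_ge0// ?mulr_ge0// ?exprn_ge0// ltW.
rewrite /f !fctE /GRing.scale /= addr0 !subr0 ln1 expr0n/=; lra.
Qed.

(** With [u = s / n], the logarithm of the ratio of the two weights is
    [n (ln (1 + u) - ln (1 - u) - 2 u)], so [ln_ratio_ge] and [1 + x <= exp x] apply. *)
Lemma pois_asym n s : 0 <= s < n%:R ->
  pois (n%:R - s) n * (1 + 2 / 3 * s ^+ 3 / n%:R ^+ 2) <= pois (n%:R + s) n.
Proof.
move=> /andP[s0 sn].
have n0 : 0 < n%:R :> R by exact: le_lt_trans sn.
pose u := s / n%:R.
have su : s = n%:R * u by rewrite /u mulrC divfK// gt_eqF.
have u0 : 0 <= u by rewrite divr_ge0// ltW.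
have u1 : u < 1 by rewrite ltr_pdivrMr// mul1r.
have u01 : 0 <= u < 1 by rewrite u0.
have Ep (x : R) : 0 < 1 + x -> pois (n%:R + n%:R * x) n =
    pois n%:R n * expR (n%:R * (ln (1 + x) - x)).
  move=> x1; rewrite mulrBr expRB expRM_natl lnK ?posrE//.
  rewrite /pois (_ : n%:R + n%:R * x = n%:R * (1 + x)) ?exprMn; last by ring.
  rewrite mulrDr mulr1 opprD expRD [expR (- (_ * _))]expRN; ring.
have -> : n%:R - s = n%:R + n%:R * (- u) by rewrite su; ring.
rewrite {2}su !Ep; try lra.
rewrite -mulrA ler_wpM2l ?pois_ge0//.
have -> : n%:R * (ln (1 + u) - u) =
  n%:R * (ln (1 - u) + u) + n%:R * (ln (1 + u) - ln (1 - u) - 2 * u) by ring.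
rewrite opprK expRD ler_wpM2l ?expR_ge0//.
apply: le_trans (expR_ge1Dx _); rewrite lerD2l.
have -> : 2 / 3 * s ^+ 3 / n%:R ^+ 2 = n%:R * (2 / 3 * u ^+ 3).
  by rewrite su; field; rewrite gt_eqF.
rewrite ler_wpM2l//; have := ln_ratio_ge _ u01; lra.
Qed.

(** With [u = s / n], the ratio of the weights is [(exp u (1 - u))^n], and
    [1 - u >= exp (- u - 2 u^2)] for [u <= 1/2]. *)
Lemma pois_near_mode n s : 0 <= s -> 2 * s <= n%:R ->
  pois n%:R n * expR (- (2 * s ^+ 2 / n%:R)) <= pois (n%:R - s) n.
Proof.
case: n => [|n] s0 sn.
  have -> : s = 0 by lra.
  by rewrite expr0n/= mulr0 mul0r oppr0 expR0 mulr1 addr0.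
pose N : R := n.+1%:R; rewrite -/N in sn *.
have N0 : 0 < N by rewrite ltr0n.
pose u := s / N.
have su : s = N * u by rewrite /u mulrC divfK// gt_eqF.
have u0 : 0 <= u by rewrite divr_ge0// ltW.
have u1 : u <= 2^-1 by rewrite ler_pdivrMr//; lra.
have -> : 2 * s ^+ 2 / N = N * (2 * u ^+ 2) by rewrite su; field; rewrite gt_eqF.
(* Taking inverses, this follows from [(1 + u + 2 u^2) (1 - u) = 1 + u^2 (1 - 2 u) >= 1]. *)
have H : expR (- (u + 2 * u ^+ 2)) <= 1 - u.
  rewrite expRN -[leRHS]invrK lef_pV2 ?posrE ?expR_gt0 ?invr_gt0; try lra.
  apply: le_trans (expR_ge1Dx _); rewrite -[leLHS]mul1r ler_pdivrMr; last by lra.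
  nra.
have -> : N - s = N * (1 - u) by rewrite su; ring.
rewrite /pois (exprMn _ N).
have -> : expR (- (N * (1 - u))) * (N ^+ n.+1 * (1 - u) ^+ n.+1) / (n.+1)`!%:R
  = expR (- N) * N ^+ n.+1 / (n.+1)`!%:R * (expR (N * u) * (1 - u) ^+ n.+1).
  by rewrite (_ : - (N * (1 - u)) = - N + N * u) ?expRD; ring.
rewrite ler_wpM2l ?(pois_ge0 N n.+1 (ltW N0))//.
apply: le_trans (_ : expR (N * u) * expR (- (u + 2 * u ^+ 2)) ^+ n.+1 <= _).
  by rewrite -expRM_natl -expRD ler_expR -/N; lra.
by rewrite ler_wpM2l ?expR_ge0// lerXn2r// nnegrE ?expR_ge0//; lra.
Qed.

(* The cdf has derivative - pois x n in the parameter x, so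
   F s = - pois_cdf (n + s) - pois_cdf (n - s) has derivative
   pois (n + s) n - pois (n - s) n >= 0, which is of order pois n n / sqrt n for
   s between sqrt n and 2 sqrt n; the claim is F 0 <= F n - c * pois n n. *)
Lemma pois_cdf_center n : (16 <= n)%N ->
  2^-1 + 3^-1 * expR (- 8) * pois n%:R n <= pois_cdf n%:R n.+1 :> R.
Proof.
move=> n16; pose N : R := n%:R; rewrite -/N.
have N16 : 16 <= N by rewrite /N (ler_nat _ 16).
have N0 : 0 <= N by lra.
pose y := Num.sqrt N.
have yy : y ^+ 2 = N by rewrite sqr_sqrtr//; lra.
have y0 : 0 <= y by rewrite sqrtr_ge0.
have y4 : 4 <= y by nra.
have y2N : 2 * y <= N / 2 by nra.
pose F (s : R) := - pois_cdf (N + s) n.+1 - pois_cdf (N - s) n.+1.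
pose dF (s : R) := pois (N + s) n - pois (N - s) n.
have dFE (x : R) : is_derive x 1 F (dF x).
  have d1 := is_derive_pois_cdf n (N + x).
  have d2 := is_derive_pois_cdf n (N - x).
  have t1 : is_derive x 1 (fun s : R => N + s) 1.
    by apply: is_derive_eq; rewrite add0r ?mulr1.
  have t2 : is_derive x 1 (fun s : R => N - s) (- 1).
    by apply: is_derive_eq; rewrite add0r ?mulr1 ?mul1r.
  have := @is_derive1_comp _ (fun m => pois_cdf m n.+1) (fun s => N + s) x _ _ d1 t1.
  rewrite mulr1 => e1.
  have := @is_derive1_comp _ (fun m => pois_cdf m n.+1) (fun s => N - s) x _ _ d2 t2.
  rewrite mulrN1 opprK => e2.
  have -> : F = - (fun s => pois_cdf (N + s) n.+1) - (fun s => pois_cdf (N - s) n.+1).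
    by apply/funext.
  by apply: is_derive_eq; rewrite opprK.
have asym x : 0 <= x -> x < N ->
    pois (N - x) n * (2 / 3 * x ^+ 3 / N ^+ 2) <= dF x.
  move=> x0 xN; rewrite /dF lerBrDl -[X in X + _]mulr1 -mulrDr.
  by apply: pois_asym; rewrite x0.
have dF0 x : 0 <= x -> x <= N -> 0 <= dF x.
  move=> x0; rewrite le_eqVlt => /predU1P[->|xN].
    rewrite /dF subrr subr_ge0; apply: le_trans (_ : 0 <= _); last by rewrite pois_ge0//; lra.
    by rewrite /pois expr0n; 
    case: n n16 {N N16 N0 y yy y0 y4 y2N F dF dFE asym x0} => //= n _; rewrite mulr0 mul0r.
  apply: le_trans (asym x x0 xN); rewrite !mulr_ge0 ?pois_ge0 ?invr_ge0 ?exprn_ge0//; lra.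
(* For [x] between [y] and [2 y], where [y^2 = N], the bound [2 x^2 / N <= 8] gives the factor
   [expR (- 8)], and [x^3 / N^2 >= 1 / y]. *)
have dFy x : y <= x -> x <= 2 * y -> 2 / 3 * expR (- 8) * pois N n / y <= dF x.
  move=> yx xy.
  have x0 : 0 <= x by lra.
  have xN : x < N by lra.
  apply: le_trans (asym x x0 xN).
  have h1 : pois N n * expR (- 8) <= pois (N - x) n.
    apply: le_trans (pois_near_mode n x x0 _); last by rewrite -/N; lra.
    rewrite ler_wpM2l ?pois_ge0//.
    by rewrite ler_expR lerN2 ler_pdivrMr -/N -?yy; nra.
  have h2 : y^-1 <= x ^+ 3 / N ^+ 2.
    rewrite ler_pdivlMr ?exprn_gt0//; last by lra.
    rewrite ler_pdivrMl; last by lra.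
    by rewrite -yy (_ : (y ^+ 2) ^+ 2 = y * y ^+ 3) ?ler_wpM2l// ?lerXn2r ?nnegrE//; ring.
  rewrite (_ : 2 / 3 * expR (- 8) * pois N n / y =
    pois N n * expR (- 8) * (2 / 3 * y^-1)); last by ring.
  rewrite (_ : 2 / 3 * x ^+ 3 / N ^+ 2 = 2 / 3 * (x ^+ 3 / N ^+ 2)); last by ring.
  apply: ler_pM => //.
  - by rewrite mulr_ge0 ?expR_ge0 ?pois_ge0//; lra.
  - by rewrite mulr_ge0 ?invr_ge0//; lra.
  - by rewrite ler_wpM2l//; lra.
(* Only the middle interval [[y, 2 y]], of length [y], contributes; on the other two it suffices
   that [F] does not decrease. *)
have i1 : 0 * (y - 0) <= F y - F 0.
  apply: (derive_ge_increment F dF) => // x /andP[x0 xy]; apply: dF0 => //; lra.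
have i2 : 2 / 3 * expR (- 8) * pois N n / y * (2 * y - y) <= F (2 * y) - F y.
  by apply: (derive_ge_increment F dF) => [|x /andP[]]; [lra|exact: dFy].
have i3 : 0 * (N - 2 * y) <= F N - F (2 * y).
  apply: (derive_ge_increment F dF) => [|x /andP[x0 xy]]; first by lra.
  apply: dF0; lra.
rewrite (_ : 2 * y - y = y) ?divfK in i2; last 2 first.
- by rewrite gt_eqF//; lra.
- by ring.
(* At [s = N] the second parameter is 0, where the cdf equals 1. *)
have FN : F N <= -1.
  rewrite /F subrr; have := @pois_cdf_le1 R N.
  have -> : pois_cdf (0 : R) n.+1 = 1.
    rewrite /pois_cdf big_ord_recl big1 ?addr0 => [|i _].
      by rewrite /pois oppr0 expR0 expr0 fact0 invr1 !mulr1.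
    by rewrite /pois expr0n/= mulr0 mul0r.
  suff : 0 <= pois_cdf (N + N) n.+1 by lra.
  by rewrite sumr_ge0// => i _; rewrite pois_ge0//; lra.
move: i1 i3; rewrite !mul0r => i1 i3.
have : F 0 = - 2 * pois_cdf N n.+1 by rewrite /F addr0 subr0; ring.
lra.
Qed.

End median.

(** * The series for large lambda *)

(* P(root_bias >= 0 | the root has k children). *)
Definition nonneg_prob {R : realType} (lambda : R) (k : nat) : R :=
  1 - pois_cdf (lambda * k%:R) (k * (k - 1)).

Section bias.
Context {R : realType}.
Implicit Types (lambda : R) (k n N M : nat).

Lemma nonneg_prob_ge0 lambda k : 0 <= lambda -> 0 <= nonneg_prob lambda k.
Proof. by move=> l0; rewrite subr_ge0 pois_cdf_le1// mulr_ge0. Qed.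

Lemma nonneg_prob_le1 lambda k : 0 <= lambda -> nonneg_prob lambda k <= 1.
Proof.
by move=> l0; rewrite lerBlDr lerDl sumr_ge0// => i _; rewrite pois_ge0// mulr_ge0.
Qed.

Lemma thresholdE k : (k * (k - 1))%:R = k%:R * (k%:R - 1) :> R.
Proof. by case: k => [|k]; rewrite ?mul0r// natrM subn1 /= -[k.+1]addn1 natrD addrK. Qed.

(** Chebyshev: the mean [lambda k] exceeds the threshold [k (k - 1)] by [k (lambda + 1 - k)], and
    the variance is [lambda k]. *)
Lemma nonneg_prob_lower lambda k : 0 < lambda -> (0 < k)%N -> k%:R < lambda + 1 ->
  1 - nonneg_prob lambda k <= lambda / (k%:R * (lambda + 1 - k%:R) ^+ 2).
Proof.
move=> l0 k0 kl; rewrite subKr.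
have kp : 0 < k%:R :> R by rewrite ltr0n.
apply: le_trans (pois_lower_tail _ (k%:R * (lambda + 1 - k%:R)) _ _ _ _) _.
- by rewrite mulr_ge0// ltW.
- by rewrite mulr_gt0// subr_gt0.
- by rewrite thresholdE; lra.
rewrite le_eqVlt; apply/orP; left; apply/eqP; field.
by apply/andP; split; rewrite gt_eqF//; lra.
Qed.

Lemma nonneg_prob_upper lambda k : 0 < lambda -> lambda + 1 < k%:R ->
  nonneg_prob lambda k <= lambda / (k%:R * (k%:R - 1 - lambda) ^+ 2).
Proof.
move=> l0 kl.
have kp : 0 < k%:R :> R by lra.
apply: le_trans (pois_upper_tail _ (k%:R * (k%:R - 1 - lambda)) _ _ _ _) _.
- by rewrite mulr_ge0// ltW.
- by rewrite mulr_gt0//; lra.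
- by rewrite thresholdE; lra.
rewrite le_eqVlt; apply/orP; left; apply/eqP; field.
by apply/andP; split; rewrite gt_eqF//; lra.
Qed.

(** Telescoping, since [1 / x^2 <= 2 / x - 2 / (x + 1)] for [x >= 1]. *)
Lemma sum_inv_sqr n k : (0 < k)%N ->
  \sum_(j < n) ((k + j)%:R ^+ 2)^-1 <= 2 / k%:R :> R.
Proof.
move=> k0; suff : \sum_(j < n) ((k + j)%:R ^+ 2)^-1 <= 2 / k%:R - 2 / (k + n)%:R :> R.
  by have : 0 <= 2 / (k + n)%:R :> R by []; lra.
elim: n => [|n IH]; first by rewrite big_ord0 addn0 subrr.
rewrite big_ord_recr/= addnS -[(k + n).+1%:R]natr1.
have x1 : 1 <= (k + n)%:R :> R by rewrite (ler_nat _ 1); lia.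
move: IH; move: (k + n)%:R x1 => x x1 IH.
suff h : (x ^+ 2)^-1 <= 2 / x - 2 / (x + 1).
  by apply: le_trans (lerD IH h) _; rewrite subrKA.
rewrite (_ : 2 / x - 2 / (x + 1) = 2 / (x * (x + 1))); last first.
  by field; apply/andP; split; rewrite gt_eqF//; lra.
rewrite ler_pdivlMr; last by nra.
rewrite mulrC ler_pdivrMr; nra.
Qed.

(* Absorbs the factor lambda / k of Chebyshev's bound for small k. *)
Lemma pois_shift_le lambda k : 0 < lambda -> (0 < k)%N ->
  pois lambda k * lambda / k%:R <= 2 * pois lambda k.+1.
Proof.
move=> l0 k0; rewrite -poisS ler_pdivrMr ?ltr0n//.
have : k.+1%:R <= 2 * k%:R :> R by rewrite -natrM ler_nat; lia.
have := pois_ge0 lambda k.+1 (ltW l0); nra.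
Qed.

(** Here [N] is the integer part of [lambda], hence a mode. The weights below [N] total at most 1/2,
    those at [N], [N + 1], [N + 2] at most 3 times the mode weight, and Chebyshev bounds the rest by
    inverse squares, at most 2 times the mode weight. *)
Lemma sum_nonneg_prob_upper lambda N n :
  0 < lambda -> N%:R <= lambda -> lambda < N.+1%:R ->
  \sum_(k < n) pois lambda k * nonneg_prob lambda k <= 2^-1 + 5 * pois lambda N.
Proof.
move=> l0 Nl lN.
have p0 k : 0 <= pois lambda k by rewrite pois_ge0// ltW.
have g0 k : 0 <= nonneg_prob lambda k by rewrite nonneg_prob_ge0// ltW.
have pm k : pois lambda k <= pois lambda N by rewrite pois_le_mode// ltW.
apply: (@le_trans _ _ (\sum_(k < N.+3 + n) pois lambda k * nonneg_prob lambda k)).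
  by rewrite addnC big_split_ord/= lerDl sumr_ge0// => k _; rewrite mulr_ge0.
rewrite big_split_ord/=.
have h1 : \sum_(k < N.+3) pois lambda k * nonneg_prob lambda k <= 2^-1 + 3 * pois lambda N.
  apply: (@le_trans _ _ (pois_cdf lambda N.+3)).
    by apply: ler_sum => k _; rewrite ler_piMr// nonneg_prob_le1// ltW.
  rewrite !pois_cdfS; have := pois_cdf_le_half lambda N Nl.
  by have := pm N.+1; have := pm N.+2; lra.
have h2 : \sum_(j < n) pois lambda (N.+3 + j) * nonneg_prob lambda (N.+3 + j)
    <= 2 * pois lambda N.
  apply: (@le_trans _ _ (\sum_(j < n) pois lambda N * ((1 + j)%:R ^+ 2)^-1)).
    apply: ler_sum => j _; apply: ler_pM => //.
    have kE : (N.+3 + j)%:R = N.+1%:R + 1 + (1 + j)%:R :> R.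
      by rewrite natr1 -natrD; congr (_%:R); lia.
    have j1 : 1 <= (1 + j)%:R :> R by rewrite (ler_nat _ 1).
    apply: le_trans (nonneg_prob_upper lambda _ l0 _) _; first by rewrite kE; lra.
    rewrite kE; move: (1 + j)%:R j1 => x x1.
    have kp : 0 < N.+1%:R + 1 + x by lra.
    have xp : 0 < N.+1%:R + 1 + x - 1 - lambda by lra.
    rewrite invfM mulrA -[leRHS]mul1r; apply: ler_pM.
    - by rewrite divr_ge0 ?ltW.
    - by rewrite invr_ge0 exprn_ge0 ?ltW.
    - by rewrite ler_pdivrMr//; lra.
    - by rewrite lef_pV2 ?posrE ?exprn_gt0 ?lerXn2r ?nnegrE//; lra.
  rewrite -mulr_sumr mulrC ler_wpM2r//.
  by have := @sum_inv_sqr n 1 isT; rewrite divr1.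
lra.
Qed.

(** Here [lambda] lies in [[N - 1, N)], so [N.-1] is a mode. For [k = N - M - j] Chebyshev gives a
    factor [1 / (M + j)^2], and [pois_shift_le] absorbs [lambda / k]. *)
Lemma sum_lower_tail lambda N M : 0 < lambda -> N%:R <= lambda + 1 -> lambda < N%:R ->
  (0 < M)%N -> (M <= N)%N ->
  \sum_(k < (N - M).+1) pois lambda k * (1 - nonneg_prob lambda k)
    <= 4 * pois lambda N.-1 / M%:R.
Proof.
move=> l0 Nl lN M0 MN.
have N0 : (0 < N)%N by lia.
have N1 : N%:R = N.-1%:R + 1 :> R by rewrite natr1 prednK.
have p0 k : 0 <= pois lambda k by rewrite pois_ge0// ltW.
have pm k : pois lambda k <= pois lambda N.-1.
  by rewrite pois_le_mode//; [lra|rewrite prednK// ltW].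
rewrite (reindex_inj rev_ord_inj)/=.
apply: (@le_trans _ _
  (\sum_(j < (N - M).+1) 2 * pois lambda N.-1 * ((M + j)%:R ^+ 2)^-1)).
  apply: ler_sum => j _; rewrite subSS; set k := (N - M - j)%N.
  have jE : (M + j = N - k)%N by have := ltn_ord j; rewrite /k; lia.
  (* At [k = 0] Chebyshev's bound would divide by zero; there the threshold is 0 and the probability
     is 1. *)
  have [->|k0] := posnP k.
    rewrite /nonneg_prob subKr mul0n pois_cdf0 mulr0 mulr_ge0 ?invr_ge0 ?exprn_ge0//.
    by rewrite mulr_ge0.
  have kN : (k < N)%N by rewrite /k; lia.
  have kNR : k%:R + 1 <= N%:R :> R by rewrite natr1 ler_nat.
  have kp : 0 < k%:R :> R by rewrite ltr0n.
  have := nonneg_prob_lower lambda k l0 k0 ltac:(lra).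
  move/(ler_wpM2l (p0 k))/le_trans; apply.
  rewrite invfM mulrA mulrA; apply: ler_pM.
  - by apply: divr_ge0; [apply: mulr_ge0; [|exact: ltW]|exact: ltW].
  - by rewrite invr_ge0 exprn_ge0//; lra.
  - by apply: le_trans (pois_shift_le lambda k l0 k0) _; rewrite ler_wpM2l.
  have -> : (M + j)%:R = N%:R - k%:R :> R by rewrite jE natrB// ltnW.
  by rewrite lef_pV2 ?posrE ?exprn_gt0 ?lerXn2r ?nnegrE//; lra.
rewrite -mulr_sumr (_ : 4 * _ / _ = 2 * pois lambda N.-1 * (2 / M%:R)); last by ring.
by apply: ler_wpM2l; [exact: mulr_ge0|exact: sum_inv_sqr].
Qed.

(** Counting form of [floor w >= w - 1]; the hypothesis keeps the bound from going negative when no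
    integer is counted. *)
Lemma count_gt (w : R) n : 0 <= n%:R - w + 1 ->
  \sum_(i < n) (w < i.+1%:R)%R%:R <= n%:R - w + 1.
Proof.
elim: n => [|n IH]; first by rewrite big_ord0.
rewrite big_ord_recr/= -natr1 => h; case: ltP => hw; last first.
  rewrite big1 ?addr0// => i _; case: ltP => // wi.
  have : i.+1%:R <= n%:R :> R by rewrite ler_nat.
  lra.
by have := IH ltac:(lra); rewrite mulr1n; lra.
Qed.

(** [count_gt] covers [z <= M + 1]. Beyond that no integer is counted, and the quadratic term
    offsets the negative linear one because [z^2 / M >= z]. *)
Lemma count_gt_quadratic (z : R) M : (0 < M)%N ->
  \sum_(i < 2 * M) (z + M%:R < i.+1%:R)%R%:R <= M%:R + 1 - z + z ^+ 2 / M%:R.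
Proof.
move=> M0; have Mp : 0 < M%:R :> R by rewrite ltr0n.
have q0 : 0 <= z ^+ 2 / M%:R by rewrite divr_ge0 ?sqr_ge0// ltW.
have [h|h] := leP 0 ((2 * M)%:R - (z + M%:R) + 1).
  by apply: le_trans (count_gt _ _ h) _; rewrite natrM; lra.
rewrite natrM in h; rewrite big1 => [|i _].
  have : z <= z ^+ 2 / M%:R by rewrite ler_pdivlMr//; nra.
  lra.
case: ltP => // wi; have : i.+1%:R <= (2 * M)%:R :> R by rewrite ler_nat.
rewrite natrM; lra.
Qed.

End bias.

(** * Conditional probabilities in a window around [N] *)

Section window.
Context {R : realType}.
Implicit Types (lambda : R) (k n N M : nat).

(* For X Poisson of parameter a and Z = (X - a) / s + c, the left-hand side is at
   most the expected number of integers j > Z with -M < j <= M, which is at most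
   M + 1 - Z + Z^2 / M; the last term only matters when Z > M + 1. *)
Lemma sum_pois_cdf_le (a s c : R) M (u : nat -> nat) :
  0 <= a -> 0 < s -> c <= 1 -> (0 < M)%N ->
  (forall i l, (i < 2 * M)%N -> (l < u i)%N -> (l%:R - a) / s + c + M%:R < i.+1%:R) ->
  \sum_(i < 2 * M) pois_cdf a (u i) <=
    M%:R + 1 - c + 2 * (a / s ^+ 2 + c ^+ 2) / M%:R.
Proof.
move=> a0 s0 c1 M0 uP.
have Mp : 0 < M%:R :> R by rewrite ltr0n.
have p0 l : 0 <= pois a l by rewrite pois_ge0.
pose z (l : nat) := (l%:R - a) / s + c.
pose B := M%:R + 1 - c + 2 * (a / s ^+ 2 + c ^+ 2) / M%:R.
(* Truncating at [n] leaves the boundary term of [pois_moment1], scaled by [- 1 / s]; it tends to 0,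
   so a bound for all large [n] is enough. *)
have cvB : (B + a / s * pois a n) @[n --> \oo] --> B.
  rewrite -[X in _ --> X]addr0 -[X in _ + X](mulr0 (a / s)).
  apply: cvgD; first exact: cvg_cst.
  by apply: cvgM; [exact: cvg_cst|exact: cvg_pois].
rewrite -/B -[leRHS](cvg_lim _ cvB)//.
apply: limr_ge; first by apply/cvg_ex; eexists; exact: cvB.
(* From this [n] on, the common range of summation contains every range [l < u i]. *)
exists (\sum_(i < 2 * M) u i)%N => // n /= un.
apply: (@le_trans _ _ (\sum_(l < n.+1) pois a l * (M%:R + 1 - z l + z l ^+ 2 / M%:R))).
  apply: (@le_trans _ _ (\sum_(i < 2 * M) \sum_(l < n.+1) pois a l * (l < u i)%N%:R)).
    apply: ler_sum => i _; rewrite /pois_cdf (big_ord_widen n.+1 (pois a)); last first.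
      by apply: leqW; apply: leq_trans un; rewrite (bigD1 i)//= leq_addr.
    by rewrite big_mkcond /=; apply: ler_sum => l _; case: ifP; rewrite ?mulr1 ?mulr0.
  rewrite exchange_big /=; apply: ler_sum => l _; rewrite -mulr_sumr.
  apply: ler_wpM2l => //; apply: le_trans (count_gt_quadratic (z l) M M0).
  by apply: ler_sum => i _; rewrite ler_nat; case: ltnP => // /uP ->.
have -> : \sum_(l < n.+1) pois a l * (M%:R + 1 - z l + z l ^+ 2 / M%:R)
   = \sum_(l < n.+1) ((M%:R + 1 - c) * pois a l + (- s^-1) * ((l%:R - a) * pois a l)
     + M%:R^-1 * (pois a l * z l ^+ 2)).
  by apply: eq_bigr => l _; rewrite /z; ring.
rewrite !big_split /= -!mulr_sumr pois_moment1.
have h1 : (M%:R + 1 - c) * pois_cdf a n.+1 <= M%:R + 1 - c.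
  by rewrite ler_piMr ?pois_cdf_le1//; lra.
have h2 : \sum_(l < n.+1) pois a l * z l ^+ 2 <= 2 * (a / s ^+ 2 + c ^+ 2).
  apply: (@le_trans _ _
    (\sum_(l < n.+1) (2 / s ^+ 2 * ((l%:R - a) ^+ 2 * pois a l) + 2 * c ^+ 2 * pois a l))).
    apply: ler_sum => l _.
    rewrite [leRHS](_ : _ = pois a l * (2 * ((l%:R - a) / s) ^+ 2 + 2 * c ^+ 2)); last first.
      by field; rewrite gt_eqF.
    apply: ler_wpM2l => //; rewrite /z; move: ((l%:R - a) / s) => y.
    by have := sqr_ge0 (y - c); lra.
  rewrite big_split /= -!mulr_sumr mulrDr; apply: lerD.
    rewrite -mulrA ler_pM2l// [leRHS]mulrC; apply: ler_wpM2l; last exact: pois_variance_le.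
    by rewrite invr_ge0 exprn_ge0// ltW.
  by apply: ler_piMr; [rewrite mulr_ge0 ?sqr_ge0|exact: pois_cdf_le1].
have h3 : M%:R^-1 * \sum_(l < n.+1) pois a l * z l ^+ 2 <= 2 * (a / s ^+ 2 + c ^+ 2) / M%:R.
  by rewrite mulrC ler_wpM2r// invr_ge0 ltW.
rewrite -/(pois_cdf a n.+1) /B (_ : - s^-1 * (- a * pois a n) = a / s * pois a n); last by ring.
lra.
Qed.

(* Poisson(lambda k) is split as Poisson(lambda (N - M)) plus an independent
   Poisson(lambda (k - N + M)); the latter fluctuates too little to matter, so
   all terms are compared with tails of one and the same distribution. *)
Lemma window_sum lambda N M : (3 <= M)%N -> (5 * M ^ 5 <= N)%N ->
  N%:R - 1 <= lambda -> lambda < N%:R ->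
  \sum_(i < 2 * M) (1 - nonneg_prob lambda (N - M + i.+1))
    <= M%:R + (N%:R - lambda) + 10 / M%:R.
Proof.
move=> M3 MN Nl lN.
have M1 : 3 <= M%:R :> R by rewrite (ler_nat _ 3).
have N5 : 5 * M%:R ^+ 5 <= N%:R :> R by rewrite -natrX -natrM ler_nat.
have MN' : (M <= N)%N by apply: leq_trans MN; rewrite expnS; nia.
set k0 := (N - M)%N.
have k0E : k0%:R = N%:R - M%:R :> R by rewrite natrB.
move: M1 N5 k0E Nl lN; set m : R := M%:R; set nn : R := N%:R; set s : R := k0%:R
  => M1 N5 sE Nl lN.
have m2 : 9 <= m ^+ 2 by nra.
have m3 : 3 * m ^+ 2 <= m ^+ 3 by rewrite (exprS _ 2) ler_wpM2r ?sqr_ge0.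
have m4 : 3 * m ^+ 3 <= m ^+ 4 by rewrite (exprS _ 3) ler_wpM2r//; lra.
have m5 : 3 * m ^+ 4 <= m ^+ 5 by rewrite (exprS _ 4) ler_wpM2r//; lra.
have mm : 3 * m <= m ^+ 2 by rewrite expr2 ler_wpM2r//; lra.
have l4 : 4 * m ^+ 5 <= lambda by lra.
have l0 : 0 < lambda by lra.
have s0 : 0 < s by lra.
have mp : 0 < m by lra.
(* [b i] is the mean of the second Poisson part, and [v i] an integer level about [lambda / m] below
   it: rarely undershot, yet cheap when subtracted from the threshold. *)
pose b i := lambda * i.+1%:R.
pose v i := Num.truncn (b i - lambda / m).
have lm : lambda / m <= lambda / 3 by rewrite ler_pM2l// lef_pV2 ?posrE.
have lm0 : 0 < lambda / m by rewrite divr_gt0.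
have bv0 i : 0 <= b i - lambda / m.
  have : 1 <= i.+1%:R :> R by rewrite (ler_nat _ 1).
  rewrite /b; nra.
have vle i : (v i)%:R <= b i - lambda / m by rewrite truncn_le.
have vgt i : b i - lambda / m < (v i)%:R + 1.
  by have /andP[_] := truncn_itv (bv0 i); rewrite -natr1.
pose T i := ((k0 + i.+1) * (k0 + i.+1 - 1))%N.
have TE i : (T i)%:R = (s + i.+1%:R) * (s + i.+1%:R - 1) :> R by rewrite thresholdE natrD.
pose u i := (T i - v i)%N.
pose y := nn - lambda.
have y0 : 0 < y by rewrite /y; lra.
have y1 : y <= 1 by rewrite /y; lra.
(* Up to the slack [3 / m] this is the shift [lambda + 1 - N]. Multiplied by [s], the slack pays for
   [lambda / m] and for the excess [2 m^2] of the quadratic threshold. *)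
pose c := 1 - y - 3 / m.
have m31 : 3 / m <= 1 by rewrite ler_pdivrMr//; lra.
have m30 : 0 < 3 / m by rewrite divr_gt0.
have im (i : nat) : (i < 2 * M)%N -> i.+1%:R <= 2 * m by rewrite /m -natrM ler_nat.
have sm : m * (2 * m ^+ 2 + 1) <= 2 * s.
  by rewrite (_ : m * (2 * m ^+ 2 + 1) = 2 * m ^+ 3 + m); [lra|ring].
have lms : lambda / m <= s / m + 1.
  rewrite -[X in _ + X](@divff _ m) ?gt_eqF// -mulrDl ler_pM2r ?invr_gt0//; lra.
have sm2 : 2 * m ^+ 2 + 1 <= 2 * (s / m) by rewrite mulrA ler_pdivlMr// mulrC.
have step1 : \sum_(i < 2 * M) pois_cdf (lambda * s) (u i)
    <= m + 1 - c + 2 * (lambda * s / s ^+ 2 + c ^+ 2) / m.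
  apply: sum_pois_cdf_le => //.
  - by rewrite mulr_ge0// ltW.
  - by rewrite /c; lra.
  - by apply: leq_trans M3.
  move=> i l /im im' lu; rewrite -/m.
  have lT : l%:R + (v i)%:R + 1 <= (T i)%:R :> R.
    by rewrite -natrD natr1 ler_nat [(l + v i)%N]addnC; move: lu; rewrite /u ltn_subRL.
  rewrite -addrA -ltrBrDr ltr_pdivrMr//.
  have := vgt i; rewrite /b => vb; rewrite TE in lT.
  have i0 : 0 <= i.+1%:R :> R by [].
  move: lT vb im' i0; set j : R := i.+1%:R => lT vb im' i0.
  have xm : j * (y - m + j - 1) <= 2 * m ^+ 2.
    rewrite expr2; nra.
  apply: (@lt_le_trans _ _ ((s + j) * (y - m + j - 1) + lambda / m)).
    rewrite /y (_ : nn = s + m); last by lra.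
    lra.
  rewrite /c (_ : (j - (1 - y - 3 / m + m)) * s =
    s * (y - m + j - 1) + 3 * (s / m)); last by ring.
  lra.
(* The union bound with levels [u i] and [v i]; Chebyshev at distance [lambda / m] from a mean of at
   most [2 m lambda] gives the error term. *)
have step2 i : (i < 2 * M)%N -> 1 - nonneg_prob lambda (k0 + i.+1)
    <= pois_cdf (lambda * s) (u i) + 2 * m ^+ 3 / lambda.
  move=> /im im'; rewrite /nonneg_prob subKr natrD mulrDr -/s -/(b i).
  have b0 : 0 <= b i by rewrite mulr_ge0// ltW.
  have a0 : 0 <= lambda * s by rewrite mulr_ge0// ltW.
  apply: (@le_trans _ _ (pois_cdf (lambda * s + b i) (u i + v i))).
    by apply: le_pois_cdf; [exact: addr_ge0|rewrite -/(T i) [(u i + v i)%N]addnC -leq_subLR].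
  apply: le_trans (pois_cdf_split _ _ _ _ a0 b0) _; rewrite lerD2l.
  apply: le_trans (pois_lower_tail _ _ _ b0 lm0 (vle i)) _.
  rewrite ler_pdivrMr ?exprn_gt0//.
  rewrite (_ : 2 * m ^+ 3 / lambda * (lambda / m) ^+ 2 = lambda * (2 * m)).
    by rewrite ler_pM2l.
  by field; rewrite !gt_eqF.
apply: (@le_trans _ _
  (\sum_(i < 2 * M) (pois_cdf (lambda * s) (u i) + 2 * m ^+ 3 / lambda))).
  by apply: ler_sum => i _; exact: step2.
rewrite big_split /= sumr_const card_ord -[_ *+ (2 * M)]mulr_natl natrM -/m.
(* The size of [N] against [M ^ 5] enters through [lambda >= 4 m^5]: the [2 M] Chebyshev errors add
   up to at most [1 / m]. *)
have e1 : 2 * m * (2 * m ^+ 3 / lambda) <= 1 / m.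
  rewrite ler_pdivlMr// [leLHS](_ : _ = (4 * m ^+ 5) / lambda); last by ring.
  by rewrite ler_pdivrMr// mul1r.
have e2 : 2 * (lambda * s / s ^+ 2 + c ^+ 2) / m <= 6 / m.
  rewrite ler_pM2r ?invr_gt0//.
  have -> : lambda * s / s ^+ 2 = lambda / s by field; rewrite gt_eqF.
  have : lambda / s <= 2 by rewrite ler_pdivrMr//; lra.
  have : c ^+ 2 <= 1 by rewrite /c; nra.
  lra.
have e3 : 1 - c = y + 3 / m by rewrite /c; ring.
rewrite -/y; have -> : 10 / m = 1 / m + 3 / m + 6 / m by ring.
lra.
Qed.
End window.

(** * The lower bound 1/2 for the series *)

Section lower.
Context {R : realType}.
Implicit Types (lambda : R) (k n N M : nat).

(** Each step to the right multiplies the weight by [lambda / (N + i + 1) >= 1 - (M + 1) / N]; the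
    factors are collected as in Bernoulli's inequality. *)
Lemma pois_right_of_mode lambda N M i : 0 < lambda -> N%:R - 1 <= lambda ->
  (M < N)%N -> (i <= M)%N ->
  pois lambda N * (1 - i%:R * (M.+1%:R / N%:R)) <= pois lambda (N + i).
Proof.
move=> l0 Nl MN; elim: i => [|i IH] iM; first by rewrite mul0r subr0 mulr1 addn0.
have {}IH := IH (ltnW iM); rewrite addnS.
have q0 := pois_ge0 lambda N (ltW l0).
have qi0 := pois_ge0 lambda (N + i) (ltW l0).
have Np : 0 < N%:R :> R by rewrite ltr0n; lia.
have a1 : M.+1%:R / N%:R <= 1 :> R by rewrite ler_pdivrMr// mul1r ler_nat.
have a0 : 0 <= M.+1%:R / N%:R :> R by rewrite divr_ge0.
have r1 : pois lambda (N + i) * (1 - M.+1%:R / N%:R) <= pois lambda (N + i).+1.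
  rewrite -(@ler_pM2r _ (N + i).+1%:R) ?ltr0n// poisS -mulrA ler_wpM2l//.
  rewrite mulrBl mul1r lerBlDr -lerBlDl -[(N + i).+1%:R]natr1 natrD.
  have : i%:R + 1 <= M%:R :> R by rewrite natr1 ler_nat.
  have : M.+1%:R <= M.+1%:R / N%:R * (N%:R + i%:R + 1) :> R.
    by rewrite mulrAC ler_pdivlMr// ler_wpM2l// -addrA lerDl.
  rewrite -[M.+1%:R]natr1; lra.
apply: le_trans r1.
rewrite -natr1 mulrDl mul1r; move: (M.+1%:R / N%:R) a0 a1 IH => a a0 a1 IH.
apply: (@le_trans _ _ (pois lambda N * (1 - i%:R * a) * (1 - a))).
  rewrite -mulrA ler_wpM2l//.
  have : 0 <= i%:R * a * a by rewrite !mulr_ge0.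
  lra.
by rewrite ler_wpM2r//; lra.
Qed.

Lemma pois_near_mode_bounds lambda N M i : (3 <= M)%N -> (5 * M ^ 5 <= N)%N ->
  N%:R - 1 <= lambda -> lambda < N%:R -> (i <= M)%N ->
  pois lambda N * (1 - (2 * M%:R ^+ 2)^-1) <= pois lambda (N + i) /\
  pois lambda N.-1 <= pois lambda N * (1 + (2 * M%:R ^+ 2)^-1).
Proof.
move=> M3 MN Nl lN iM.
have M1 : 3 <= M%:R :> R by rewrite (ler_nat _ 3).
have N5 : 5 * M%:R ^+ 5 <= N%:R :> R by rewrite -natrX -natrM ler_nat.
have MN' : (M < N)%N by apply: leq_trans MN; rewrite expnS; nia.
have ME : M.+1%:R = M%:R + 1 :> R by rewrite -natr1.
have NE : N%:R = N.-1%:R + 1 :> R by rewrite natr1 prednK//; lia.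
have h := pois_right_of_mode lambda N M i.
have Np : N = N.-1.+1 by rewrite prednK//; lia.
have := poisS lambda N.-1; rewrite -Np => hS.
have iMR : i%:R <= M%:R :> R by rewrite ler_nat.
move: M1 N5 ME NE Nl lN h hS iMR; set m : R := M%:R; set nn : R := N%:R; set m' : R := M.+1%:R
  => M1 N5 ME NE Nl lN h hS iMR.
have m2 : 9 <= m ^+ 2 by nra.
have m3 : 3 * m ^+ 2 <= m ^+ 3 by rewrite (exprS _ 2) ler_wpM2r ?sqr_ge0.
have m4 : 3 * m ^+ 3 <= m ^+ 4 by rewrite (exprS _ 3) ler_wpM2r//; lra.
have m5 : 3 * m ^+ 4 <= m ^+ 5 by rewrite (exprS _ 4) ler_wpM2r//; lra.
have mm : 3 * m <= m ^+ 2 by rewrite expr2 ler_wpM2r//; lra.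
have l0 : 0 < lambda by lra.
have q0 := pois_ge0 lambda N (ltW l0).
split.
  apply: le_trans (h l0 Nl MN' iM); rewrite ler_wpM2l// lerD2l lerN2.
  apply: (@le_trans _ _ (m * (m' / nn))).
    by rewrite ler_wpM2r// divr_ge0.
  rewrite mulrA ler_pdivrMr; last by lra.
  rewrite ler_pdivlMl; last by lra.
  rewrite ME (_ : 2 * m ^+ 2 * (m * (m + 1)) = 2 * m ^+ 4 + 2 * m ^+ 3); last by ring.
  lra.
rewrite -(@ler_pM2r _ lambda)// -hS -[leRHS]mulrA ler_wpM2l//.
rewrite mulrDl mul1r -lerBlDl.
rewrite ler_pdivlMl; last by lra.
nra.
Qed.

(** Comparison with the cdf at [N.+1]: the terms left of the window lose at most [8 q / M], the
    window terms up to [N] lose at most [pm A], and those beyond [N] gain at least [pl (M - B)]. By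
    [window_sum] the net loss in the window is at most [(N - lambda) q], which [center] cancels,
    plus [11 q / M]. This gives the constant 19. *)
Lemma sum_nonneg_prob_lower lambda N M : (3 <= M)%N -> (5 * M ^ 5 <= N)%N ->
  19 / M%:R <= 3^-1 * expR (- 8) :> R ->
  N%:R - 1 <= lambda -> lambda < N%:R ->
  2^-1 <= \sum_(k < (N - M).+1 + (M + M)) pois lambda k * nonneg_prob lambda k.
Proof.
move=> M3 MN Mc Nl lN.
have M1 : 3 <= M%:R :> R by rewrite (ler_nat _ 3).
have N3 : (M ^ 5 <= N)%N by apply: leq_trans MN; lia.
have MN' : (M < N)%N by apply: leq_trans MN; rewrite expnS; nia.
have N16 : (16 <= N)%N.
  by apply: leq_trans N3; apply: (@leq_trans (3 ^ 5)%N); rewrite ?leq_exp2r.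
have NE : N%:R = N.-1%:R + 1 :> R by rewrite natr1 prednK//; lia.
have N16R : 16 <= N%:R :> R by rewrite (ler_nat _ 16).
have l0 : 0 < lambda by lra.
pose p k := pois lambda k; pose g k := nonneg_prob lambda k.
have p0 k : 0 <= p k by rewrite /p pois_ge0// ltW.
have g0 k : 0 <= g k by rewrite /g nonneg_prob_ge0// ltW.
have g1 k : g k <= 1 by rewrite /g nonneg_prob_le1// ltW.
pose q := p N; pose pm := p N.-1.
have ppm k : p k <= pm.
  by rewrite /pm /p pois_le_mode//; [lra|rewrite prednK ?ltW//; lia].
have [_ pmq] := pois_near_mode_bounds lambda N M 0 M3 MN Nl lN isT.
have center : 2^-1 + 3^-1 * expR (- 8) * q + (N%:R - lambda) * q <= pois_cdf lambda N.+1.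
  apply: le_trans (pois_cdf_below lambda N (ltW l0) (ltW lN)); rewrite lerD2r.
  apply: le_trans (pois_cdf_center N N16); rewrite lerD2l; apply: ler_wpM2l.
    by rewrite mulr_ge0 ?expR_ge0.
  by apply: pois_nondecreasing => //; exact: ltW.
have tail := sum_lower_tail lambda N M l0 ltac:(lra) lN ltac:(lia) ltac:(lia).
have win := window_sum lambda N M M3 MN Nl lN.
have cdfE : pois_cdf lambda N.+1 = \sum_(k < (N - M).+1) p k
    + \sum_(i < M) p ((N - M).+1 + i)%N.
  by rewrite /pois_cdf [in LHS](_ : N.+1 = (N - M).+1 + M)%N ?big_split_ord//; lia.
rewrite mul2n -addnn big_split_ord/= in win.
rewrite big_split_ord big_split_ord/=.
have kE i : ((N - M).+1 + i = N - M + i.+1)%N by rewrite addnS addSn.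
have kE' i : ((N - M).+1 + (M + i) = N + i.+1)%N by lia.
have kE'' i : (N - M + (M + i).+1 = N + i.+1)%N by lia.
pose A := \sum_(i < M) (1 - g (N - M + i.+1)%N).
pose B := \sum_(i < M) (1 - g (N + i.+1)%N).
have {}win : A + B <= M%:R + (N%:R - lambda) + 10 / M%:R.
  apply: le_trans win; rewrite lerD2l; apply: ler_sum => i _; by rewrite kE''.
have A0 : 0 <= A by rewrite sumr_ge0// => i _; rewrite subr_ge0.
have B0 : 0 <= B by rewrite sumr_ge0// => i _; rewrite subr_ge0.
have AM : A <= M%:R.
  rewrite -[leRHS](_ : \sum_(i < M) 1 = _); last by rewrite sumr_const card_ord.
  by apply: ler_sum => i _; rewrite lerBlDr lerDl.
have s1 : \sum_(k < (N - M).+1) p k * g k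
    = \sum_(k < (N - M).+1) p k - \sum_(k < (N - M).+1) p k * (1 - g k).
  by rewrite -sumrB; apply: eq_bigr => k _; ring.
have s2 : \sum_(i < M) p ((N - M).+1 + i)%N - pm * A
    <= \sum_(i < M) p ((N - M).+1 + i)%N * g ((N - M).+1 + i)%N.
  rewrite /A mulr_sumr -sumrB; apply: ler_sum => i _; rewrite -kE.
  have := ppm ((N - M).+1 + i)%N; have := g1 ((N - M).+1 + i)%N; nra.
pose pl := q * (1 - (2 * M%:R ^+ 2)^-1).
have s3 : pl * (M%:R - B)
    <= \sum_(i < M) p ((N - M).+1 + (M + i))%N * g ((N - M).+1 + (M + i))%N.
  have -> : M%:R - B = \sum_(i < M) g (N + i.+1)%N.
    rewrite /B sumrB sumr_const card_ord; ring.
  rewrite mulr_sumr; apply: ler_sum => i _; rewrite kE' ler_wpM2r//.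
  by case: (pois_near_mode_bounds lambda N M i.+1 M3 MN Nl lN (ltn_ord i)).
have q0 : 0 <= q := p0 N.
have M2 : 18 <= 2 * M%:R ^+ 2 :> R by nra.
have eps1 : (2 * M%:R ^+ 2)^-1 <= 1 :> R by rewrite invf_le1; lra.
have eps0 : 0 <= (2 * M%:R ^+ 2)^-1 :> R by rewrite invr_ge0; lra.
have epsM : (2 * M%:R ^+ 2)^-1 * M%:R = 2^-1 / M%:R :> R.
  by field; rewrite gt_eqF//; lra.
have Mi0 : 0 < M%:R^-1 :> R by rewrite invr_gt0; lra.
have pl0 : 0 <= pl by rewrite mulr_ge0//; lra.
have plq : pl <= q by rewrite ler_piMr//; lra.
have pm2 : pm <= 2 * q by apply: le_trans pmq _; rewrite -/(p N) -/q; nra.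
(* The weights are nearly constant across the window: [pm - pl <= q / M^2], while [A <= M]. *)
have diff : (pm - pl) * A <= q / M%:R.
  apply: (@le_trans _ _ ((pm - pl) * M%:R)).
    apply: ler_wpM2l => //; rewrite subr_ge0; apply: le_trans plq _; exact: ppm.
  apply: (@le_trans _ _ (q * 2 * ((2 * M%:R ^+ 2)^-1 * M%:R))).
    rewrite mulrA; apply: ler_wpM2r; first by lra.
    by move: pmq; rewrite /pl -/(p N) -/q -/(p N.-1) -/pm; lra.
  rewrite epsM; lra.
have e1 : 4 * pm / M%:R <= 8 * (q / M%:R).
  by rewrite mulrA; apply: ler_wpM2r; [exact: ltW|lra].
have e2 : pl * ((N%:R - lambda) + 10 / M%:R) <= q * (N%:R - lambda) + 10 * (q / M%:R).
  rewrite (_ : _ + 10 * _ = q * ((N%:R - lambda) + 10 / M%:R)); last by ring.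
  by apply: ler_wpM2r => //; apply: addr_ge0 => //; lra.
have e3 : 19 * (q / M%:R) <= 3^-1 * expR (- 8) * q.
  by rewrite (_ : 19 * (q / M%:R) = 19 / M%:R * q) ?ler_wpM2r//; ring.
have e4 : pl * (A - (N%:R - lambda) - 10 / M%:R) <= pl * (M%:R - B).
  by rewrite ler_wpM2l//; lra.
have {}tail : \sum_(k < (N - M).+1) p k * (1 - g k) <= 4 * pm / M%:R := tail.
have -> : \sum_(k < (N - M).+1) pois lambda k * nonneg_prob lambda k =
  \sum_(k < (N - M).+1) p k * g k by [].
rewrite s1; lra.
Qed.

End lower.

(** * The law of the root bias *)

Lemma measure_fibers {d : measure_display} {T : measurableType d} {R : realType}
    (P : {measure set T -> \bar R}) (E : set T) (f : T -> nat) n :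
  (forall i, measurable (E `&` f @^-1` [set i])) ->
  (P (E `&` [set x | (f x < n)%N]) = \sum_(i < n) P (E `&` f @^-1` [set (i : nat)]))%E.
Proof.
move=> mE; rewrite -(@measure_bigsetU _ _ _ P (fun i => E `&` f @^-1` [set i]))//.
  rewrite -(bigcup_mkord n (fun i => E `&` f @^-1` [set i])).
  congr (P _); apply/seteqP; split => x /=.
    by move=> [Ex fx]; exists (f x).
  by move=> [i /= ni [Ex ->]].
exact: trivIset_preimage1_in.
Qed.

Lemma pois_tail_series {R : realType} (m : R) (T : nat) :
  (\sum_(T <= l <oo) (pois m l)%:E = (1 - pois_cdf m T)%:E)%E.
Proof.
apply/cvg_lim => //; rewrite -(cvg_shiftn T).
have -> : (fun n => \sum_(T <= l < n + T) (pois m l)%:E)%E =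
    (fun n => (pois_cdf m (n + T) - pois_cdf m T)%:E).
  apply/funext => n; rewrite sumEFin; congr (_%:E).
  rewrite /pois_cdf -!(big_mkord xpredT (fun l => pois m l)).
  by rewrite [X in X - _](big_cat_nat (n := T))//= ?leq_addl// addrAC subrr add0r.
apply: cvg_EFin; first by apply: nearW.
apply: cvgB; last exact: cvg_cst.
by rewrite (cvg_shiftn T); exact: cvg_pois_cdf.
Qed.

Section galton_watson.
Context {R : realType} {d : measure_display} {T : measurableType d}
  {P : probability T R} {lambda : R} {N : seq nat -> {RV P >-> nat}}.
Context (lambda0 : 0 < lambda) (GW : poisson_galton_watson lambda N).

(** The first [k] labels are summed whatever the degree of the root, which makes the sum independent
    of [N [::]]. *)
Let S (k : nat) (x : T) : nat := (\sum_(j < k) N [:: nat_of_ord j] x)%N.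

Let mN w (A : set nat) : measurable (N w @^-1` A).
Proof. by rewrite -[X in measurable X]setTI; exact: measurable_funPT. Qed.

Let mS k i : measurable (S k @^-1` [set i]).
Proof.
elim: k i => [|k IH] i.
  have -> : S 0 @^-1` [set i] = if i == 0%N then setT else set0.
    apply/seteqP; split => x /=; rewrite /S big_ord0; first by move=> <-.
    by case: eqP.
  by case: ifP.
have -> : S k.+1 @^-1` [set i] =
    \bigcup_j (S k @^-1` [set j] `&` N [:: k] @^-1` [set l | (j + l)%N = i]).
  apply/seteqP; split => x /=; rewrite /S big_ord_recr /=.
    by move=> <-; eexists; [|split].
  by move=> [j _ [/= <- <-]].
by apply: bigcup_measurable => j _; exact: measurableI.
Qed.

Let pN w i : P (N w @^-1` [set i]) = (pois lambda i)%:E.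
Proof.
rewrite (_ : _ @^-1` _ = [set x | N w x = i])//.
by case: GW => -> _; rewrite /poisson_pmf lambda0 /pois mulrC mulrA.
Qed.

(** The extra vertices [s] make the induction work: once [S k] is fixed, the constraint on [S k.+1]
    becomes one on [N [:: k]], which joins [s]; [poisD] then sums the cases. In the application [s]
    is the root alone. *)
Lemma grandchildren_joint_law k l (s : seq (seq nat)) (A : seq nat -> set nat) :
  uniq s -> (forall j, (j < k)%N -> [:: j] \notin s) ->
  (P (S k @^-1` [set l] `&` \bigcap_(w in [set` s]) (N w @^-1` A w)) =
   (pois (lambda * k%:R) l)%:E * \prod_(w <- s) P (N w @^-1` A w))%E.
Proof.
elim: k l s A => [|k IH] l s A us ks.
  case: GW => _ indep.
  (* With [0 ^+ 0 = 1], [pois 0] is the point mass at 0, the law of the empty sum. *)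
  have S0 x : S 0 x = 0%N by rewrite /S big_ord0.
  rewrite mulr0; case: l => [|l].
    rewrite (_ : S 0 @^-1` [set 0%N] = setT); last by apply/seteqP; split => x //= _.
    by rewrite setTI indep// /pois oppr0 expR0 expr0 fact0 divr1 mulr1 mul1e.
  rewrite (_ : S 0 @^-1` [set l.+1] = set0);
    last by apply/seteqP; split => x //=; rewrite S0.
  by rewrite set0I measure0 /pois expr0n/= mulr0 mul0r mul0e.
set E := S k.+1 @^-1` [set l] `&` \bigcap_(w in [set` s]) (N w @^-1` A w).
have mE : measurable E.
  apply: measurableI => //; apply: fin_bigcap_measurable => // w _; exact: mN.
(* On [E] the partial sum [S k] is at most [l], so only finitely many values have to be
   separated. *)
have -> : E = E `&` [set x | (S k x < l.+1)%N].
  rewrite setIidl// => x [/= <- _]; rewrite ltnS /S big_ord_recr/=; exact: leq_addr.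
rewrite measure_fibers; last by move=> i; exact: measurableI.
have ksk : [:: k] \notin s by exact: ks.
have step (i : 'I_l.+1) : (P (E `&` S k @^-1` [set nat_of_ord i]) =
    (pois (lambda * k%:R) i * pois lambda (l - i))%:E *
    \prod_(w <- s) P (N w @^-1` A w))%E.
  pose A' (w : seq nat) := if w == [:: k] then [set (l - i)%N] else A w.
  have A's w : w \in s -> A' w = A w.
    by move=> ws; rewrite /A'; case: eqP => // wk; rewrite wk (negbTE ksk) in ws.
  have -> : E `&` S k @^-1` [set nat_of_ord i] =
      S k @^-1` [set nat_of_ord i] `&` \bigcap_(w in [set` [:: k] :: s]) (N w @^-1` A' w).
    have il : (i <= l)%N by rewrite -ltnS.
    apply/seteqP; split => x.
      move=> [[/= Sl Es] Si]; split => // w /=.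
      rewrite inE => /predU1P[->|ws]; last by rewrite A's//; exact: Es.
      rewrite /A' eqxx /=; move: Sl Si; rewrite /S big_ord_recr/=; lia.
    move=> [/= Si Es]; split => //; split.
      have := Es [:: k]; rewrite /= inE eqxx => /(_ isT); rewrite /A' eqxx /= => Nk.
      by rewrite /S big_ord_recr/= -/(S k x) Si Nk subnKC.
    by move=> w /= ws; rewrite -A's//; apply: Es; rewrite /= inE ws orbT.
  rewrite IH /=; last 2 first.
  - by rewrite ksk.
  - move=> j jk; rewrite inE negb_or ks ?(ltnW jk)// ?andbT; last exact: ltnW.
    by apply/eqP => -[] jk'; rewrite jk' ltnn in jk.
  rewrite big_cons {1}/A' eqxx pN EFinM muleA; congr (_ * _)%E.
  by apply: eq_big_seq => w /A's ->.
rewrite (eq_bigr _ (fun i _ => step i)) -ge0_sume_distrl; last first.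
  by move=> i _; rewrite lee_fin mulr_ge0// pois_ge0 ?mulr_ge0// ltW.
by rewrite sumEFin -poisD -natr1 mulrDr mulr1.
Qed.

(** After multiplication by the degree [k], the summands 1 contribute [k] and lower [k^2] to
    [k (k - 1)]. For [k = 0] both sides hold. *)
Lemma root_bias_nonnegE (x : T) :
  (0 <= root_bias N x) =
  (N [::] x * (N [::] x - 1) <= \sum_(j < N [::] x) N [:: nat_of_ord j] x)%N.
Proof.
rewrite /root_bias; case: (N [::] x) => [|k]; first by rewrite eqxx mulr0 lexx big_ord0.
rewrite mulr1 subr_ge0 ler_pdivlMl ?ltr0n//.
rewrite big_split/= sumr_const card_ord -natr_sum -natrD -natrM ler_nat subn1/=.
by rewrite mulnS addnC leq_add2r.
Qed.

Lemma root_bias_nonneg_prob :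
  (distribution P (root_bias N) `[0%R, +oo[%classic =
   \sum_(0 <= k <oo) (pois lambda k * nonneg_prob lambda k)%:E)%E.
Proof.
pose t k := (k * (k - 1))%N.
pose F k := N [::] @^-1` [set k] `&` [set x | (t k <= S k x)%N].
have FE : root_bias N @^-1` `[0%R, +oo[%classic = \bigcup_k F k.
  apply/seteqP; split => x /=.
    rewrite in_itv/= andbT root_bias_nonnegE => h.
    by exists (N [::] x).
  move=> [k _ [/= Nk]]; rewrite in_itv/= andbT root_bias_nonnegE Nk.
  exact.
have mG k : measurable (N [::] @^-1` [set k] `&` [set x | (S k x < t k)%N]).
  apply: measurableI => //.
  rewrite (_ : [set x | _] = \bigcup_(i in `I_(t k)) (S k @^-1` [set i])).
    by apply: bigcup_measurable => i _.
  by apply/seteqP; split => x /= => [h|[i /= h ->]]; [exists (S k x)|].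
(* Passing to the complement leaves a finite union of level sets of [S k], to which
   [grandchildren_joint_law] applies. *)
have FD k : F k = N [::] @^-1` [set k] `\`
    (N [::] @^-1` [set k] `&` [set x | (S k x < t k)%N]).
  rewrite setDIr setDv set0U /F setDE; congr (_ `&` _).
  by apply/seteqP; split => x /=; rewrite ltnNge; [move=> ->|move/negP; rewrite negbK].
have mF k : measurable (F k) by rewrite FD; exact: measurableD.
rewrite /distribution /pushforward FE measure_semi_bigcup//; last 2 first.
- by move=> i j _ _ [x [[/= <- _] [/= <- _]]].
- exact: bigcup_measurable.
apply: eq_eseriesr => k _; rewrite FD measureD//; last first.
  by apply: le_lt_trans (probability_le1 P _) _; rewrite ?ltry.
rewrite setIA setIid.
have pk (i : 'I_(t k)) : (P (N [::] @^-1` [set k] `&` S k @^-1` [set nat_of_ord i]) =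
    (pois (lambda * k%:R) i * pois lambda k)%:E)%E.
  have := grandchildren_joint_law k i [:: [::]] (fun=> [set k]) isT (fun _ _ => isT).
  by rewrite bigcap_seq !big_seq1 pN setIC => ->.
have -> : (P (N [::] @^-1` [set k]) -
    P (N [::] @^-1` [set k] `&` [set x | (S k x < t k)%N]) =
    (pois lambda k)%:E - \sum_(i < t k) (pois (lambda * k%:R) i * pois lambda k)%:E)%E.
  rewrite -(eq_bigr _ (fun i _ => pk i)); congr (_ - _)%E; first exact: pN.
  by apply: measure_fibers => i; exact: measurableI.
rewrite sumEFin -EFinB -mulr_suml; congr (_%:E).
by rewrite /nonneg_prob /pois_cdf; ring.
Qed.

End galton_watson.

(** * Passage to the limits *)

Section limits.
Context {R : realType}.
Implicit Types (lambda : R) (k n N M : nat).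

(** The [M] weights from [N] on are each at least half of [pois lambda N] and sum to at most 1; the
    weight at the mode [N.-1] is only slightly larger than at [N]. *)
Lemma pois_mode_le lambda N M : (3 <= M)%N -> (5 * M ^ 5 <= N)%N ->
  N%:R - 1 <= lambda -> lambda < N%:R -> pois lambda N.-1 <= 4 / M%:R.
Proof.
move=> M3 MN Nl lN.
have M1 : 3 <= M%:R :> R by rewrite (ler_nat _ 3).
have MN' : (M < N)%N by apply: leq_trans MN; rewrite expnS; nia.
have l0 : 0 <= lambda.
  have : 3 <= N%:R :> R by rewrite (ler_nat _ 3); lia.
  lra.
have [_ pmq] := pois_near_mode_bounds lambda N M 0 M3 MN Nl lN isT.
have q0 := pois_ge0 lambda N l0.
have eps : (2 * M%:R ^+ 2)^-1 <= 2^-1 :> R by rewrite lef_pV2 ?posrE; nra.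
have : pois lambda N * 2^-1 * M%:R <= 1.
  apply: le_trans (pois_cdf_le1 lambda (N + M) l0).
  rewrite /pois_cdf big_split_ord/=; apply: ler_wpDl.
    by apply: sumr_ge0 => i _; exact: pois_ge0.
  rewrite mulr_natr -[X in _ *+ X](card_ord M) -sumr_const; apply: ler_sum => i _.
  have [h _] := pois_near_mode_bounds lambda N M i M3 MN Nl lN (ltnW (ltn_ord i)).
  by apply: le_trans h; rewrite ler_wpM2l//; lra.
move=> h; rewrite ler_pdivlMr; last by lra.
nra.
Qed.

(** The lower bound takes [N] to be the integer part of [lambda] plus 1, the upper bound the integer
    part itself. The constant 20 is 5 from [sum_nonneg_prob_upper] times 4 from [pois_mode_le]. *)
Lemma sum_nonneg_prob_near_half lambda M : (3 <= M)%N ->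
  19 / M%:R <= 3^-1 * expR (- 8) :> R -> (5 * M ^ 5)%:R <= lambda ->
  (exists n, 2^-1 <= \sum_(k < n) pois lambda k * nonneg_prob lambda k) /\
  (forall n, \sum_(k < n) pois lambda k * nonneg_prob lambda k <= 2^-1 + 20 / M%:R).
Proof.
move=> M3 Mc Ml.
have l0 : 0 <= lambda by exact: le_trans Ml.
have /andP[Nl lN] := truncn_itv l0.
have MN : (5 * M ^ 5 <= (Num.truncn lambda).+1)%N.
  by rewrite -(ler_nat R); apply: le_trans Ml (ltW lN).
set N := (Num.truncn lambda).+1 in lN MN.
have Nl' : N%:R - 1 <= lambda by rewrite /N -natr1 addrK.
split.
  by eexists; apply: (sum_nonneg_prob_lower lambda N M).
move=> n; have lp : 0 < lambda.
  by apply: lt_le_trans Ml; rewrite ltr0n muln_gt0 expn_gt0; lia.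
apply: le_trans (sum_nonneg_prob_upper lambda _ n lp Nl lN) _.
by have := pois_mode_le lambda N M M3 MN Nl' lN; rewrite /= ; lra.
Qed.

End limits.

Theorem theorem4p1 (R : realType)
    (mu : R -> probability (measurableTypeR R) R)
    (hmu : forall lambda : R, 0 < lambda -> root_bias_law lambda (mu lambda)) :
  [/\ forall lambda : R, 0 < lambda ->
        (mu lambda `[0%R, +oo[%classic =
         \sum_(0 <= k <oo)
           ((expR (- lambda) * lambda ^+ k / k`!%:R)%:E *
            \sum_(k * (k - 1) <= l <oo)
              (expR (- (lambda * k%:R)) * (lambda * k%:R) ^+ l / l`!%:R)%:E))%E,
      (mu lambda `[0%R, +oo[%classic @[lambda --> 0^'+] --> 1%E),
      (mu lambda `[0%R, +oo[%classic @[lambda --> +oo%R] --> (2^-1 : R)%:E),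
      (\forall lambda \near 0^'+, significant (mu lambda)) &
      (\forall lambda \near +oo%R, significant (mu lambda))].
Proof.
have muE (lambda : R) : 0 < lambda -> (mu lambda `[0%R, +oo[%classic =
    \sum_(0 <= k <oo) (pois lambda k * nonneg_prob lambda k)%:E)%E.
  move=> l0; have [d [T [P [N [GW muP]]]]] := hmu lambda l0.
  by rewrite muP// (root_bias_nonneg_prob l0 GW).
have pg0 (lambda : R) k : 0 < lambda -> 0 <= pois lambda k * nonneg_prob lambda k.
  by move=> l0; rewrite mulr_ge0 ?pois_ge0 ?nonneg_prob_ge0// ltW.
have mu_ge (lambda : R) n : 0 < lambda ->
    ((\sum_(k < n) pois lambda k * nonneg_prob lambda k)%:E
      <= mu lambda `[0%R, +oo[%classic)%E.
  move=> l0; rewrite muE// -(big_mkord xpredT (fun k => pois lambda k * nonneg_prob lambda k)).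
  rewrite -sumEFin; apply: nneseries_lim_ge => k _ _; rewrite lee_fin; exact: pg0.
have mu_le (lambda : R) (b : R) : 0 < lambda ->
    (forall n, \sum_(k < n) pois lambda k * nonneg_prob lambda k <= b) ->
    (mu lambda `[0%R, +oo[%classic <= b%:E)%E.
  move=> l0 hb; rewrite muE//; apply: lime_le.
    by apply: is_cvg_nneseries => k _ _; rewrite lee_fin; exact: pg0.
  by apply: nearW => n; rewrite big_mkord sumEFin lee_fin.
(* Only the term [k = 0] is kept: a childless root has bias 0. *)
have mu_exp (lambda : R) : 0 < lambda ->
    ((expR (- lambda))%:E <= mu lambda `[0%R, +oo[%classic)%E.
  move=> l0; apply: le_trans (mu_ge lambda 1%N l0).
  by rewrite big_ord1 /pois /nonneg_prob mul0n pois_cdf0 subr0 expr0 fact0 divr1 !mulr1.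
have c0 : 0 < 3^-1 * expR (- 8) :> R by rewrite mulr_gt0 ?expR_gt0.
have nat_ge (x : R) : 0 <= x -> x <= (Num.truncn x).+1%:R.
  by move=> /truncn_itv/andP[_ /ltW].
pose x0 : R := 19 / (3^-1 * expR (- 8)).
have x00 : 0 <= x0 by rewrite divr_ge0// ltW.
(* At least 3 and above [x0], so every [M >= M0] meets the smallness condition on [19 / M]. *)
pose M0 := (Num.truncn x0).+3.
have M0P M : (M0 <= M)%N -> (3 <= M)%N /\ 19 / M%:R <= 3^-1 * expR (- 8) :> R.
  move=> MM; have M3 : (3 <= M)%N by apply: leq_trans MM.
  split => //; rewrite ler_pdivrMr; last by rewrite ltr0n; lia.
  rewrite mulrC -ler_pdivrMr// -/x0.
  by apply: le_trans (nat_ge _ x00) _; rewrite ler_nat; apply: leq_trans MM; rewrite /M0; lia.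
have mu_half M (lambda : R) : (M0 <= M)%N -> (5 * M ^ 5)%:R <= lambda ->
    ((2^-1)%:E <= mu lambda `[0%R, +oo[%classic <= (2^-1 + 20 / M%:R)%:E)%E.
  move=> /M0P[M3 Mc] Ml.
  have lp : 0 < lambda.
    by apply: lt_le_trans Ml; rewrite ltr0n muln_gt0 expn_gt0; lia.
  have [[n hn] hb] := sum_nonneg_prob_near_half lambda M M3 Mc Ml.
  rewrite mu_le// andbT; apply: le_trans (mu_ge lambda n lp); exact: hn.
have exp_cvg : (expR (- lambda))%:E @[lambda --> (0 : R)^'+] --> (1%E : \bar R).
  apply: cvg_EFin; first by apply: nearW.
  rewrite /= [X in _ --> X](_ : 1 = expR (- 0)); last by rewrite oppr0 expR0.
  apply: cvg_at_right_filter; apply: continuous_cvg; first exact: continuous_expR.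
  exact: opp_continuous.
split.
- move=> lambda l0; rewrite muE//; apply: eq_eseriesr => k _.
  by rewrite EFinM; congr (_ * _)%E; rewrite -[LHS]pois_tail_series.
- apply: (squeeze_cvge _ exp_cvg (cvg_cst _)); near=> lambda.
  by rewrite mu_exp//= probability_le1.
- apply: cvg_EFin.
    by apply: nearW => lambda; exact: fin_num_measure.
  apply/cvgrPdist_le => e e0.
  pose M := (M0 + (Num.truncn (20 / e)).+1)%N.
  near=> lambda.
  have /andP[] : ((2^-1)%:E <= mu lambda `[0%R, +oo[%classic <= (2^-1 + 20 / M%:R)%:E)%E.
    by apply: mu_half; [exact: leq_addr|near: lambda; exact: nbhs_pinfty_ge].
  have /fineK /= <- : mu lambda `[0%R, +oo[%classic \is a fin_num by exact: fin_num_measure.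
  rewrite !lee_fin /= => h1 h2.
  have Me : 20 / M%:R <= e.
    have Mp : 0 < M%:R :> R by rewrite ltr0n /M; lia.
    rewrite ler_pdivrMr// mulrC -ler_pdivrMr//.
    have h : 0 <= 20 / e by rewrite divr_ge0// ltW.
    by apply: le_trans (nat_ge _ h) _; rewrite ler_nat leq_addl.
  rewrite distrC ger0_norm; lra.
(* For [lambda <= 1/2], [exp (- lambda) >= 1 - lambda >= 1/2]. *)
- near=> lambda; rewrite /significant.
  apply: le_trans (mu_exp lambda _) => //; rewrite lee_fin.
  apply: le_trans (expR_ge1Dx _).
  have : lambda <= 2^-1 by near: lambda; exact: nbhs_right_le.
  lra.
- near=> lambda.
  have Ml : (5 * M0 ^ 5)%:R <= lambda by near: lambda; exact: nbhs_pinfty_ge.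
  by have /andP[] := mu_half M0 lambda (leqnn _) Ml.
Unshelve. all: by end_near.
Qed.
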